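(* Let $X$ be a Tychonoff space and let $bX$ be a Hausdorff compactification of $X$. Put $R=bX\setminus X$ and assume that $R$ is charming. Let $Y$ be a Lindelöf $\Sigma$ kernel of $R$. If there exists a compact set $K\subseteq bX$ of countable character in $bX$ such that $Y=K\cap R$, then $R$ is a $D$-space.
   Context: All spaces are Tychonoff (completely regular and Hausdorff); subsets carry the subspace topology. A Hausdorff compactification $bX$ of $X$ is a compact Hausdorff space containing $X$ as a dense subspace. A set $K$ has countable character in $bX$ if there is a countable family of open sets containing $K$ such that every open set containing $K$ contains a member of the family. A space $X$ is a $D$-space if for every neighborhood assignment $\varphi$ (a map assigning to each $x\in X$ an open set $\varphi(x)\ni x$) there is a closed discrete set $D\subseteq X$ with $X=\bigcup_{d\in D}\varphi(d)$. A space $Z$ is Lindelöf $\Sigma$ if there are a second countable Tychonoff space $M$ and a map $\Phi$ from $M$ to the nonempty compact subsets of $Z$ that is upper semicontinuous (for each open $U\subseteq Z$, $\{m\in M:\Phi(m)\subseteq U\}$ is open in $M$) with $Z=\bigcup_{m\in M}\Phi(m)$. A space $R$ is charming if it has a Lindelöf $\Sigma$ subspace $Y$ such that for every open $U\subseteq R$ with $Y\subseteq U$, the subspace $R\setminus U$ is Lindelöf $\Sigma$; such a $Y$ is called a Lindelöf $\Sigma$ kernel of $R$. *)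

(* Defs.v *)
From mathcomp Require Import all_boot all_classical all_reals.
From mathcomp Require Import topology urysohn.

Set Implicit Arguments.
Unset Strict Implicit.
Unset Printing Implicit Defensive.

Local Open Scope classical_set_scope.

(* A subset [A : set T] regarded as a space in its own right is [set_type A],
   which the library equips with the subspace topology. *)

Definition tychonoff_space (T : topologicalType) : Prop :=
  hausdorff_space T /\ completely_regular_space T.

Definition topological_embedding (X Z : topologicalType) (e : X -> Z) : Prop :=
  injective e /\
  (forall U : set X, open U <-> exists2 V : set Z, open V & e @^-1` V = U).

(* [bX], with [X] identified with the subspace [range e]. *)
Definition hausdorff_compactification (X bX : topologicalType) (e : X -> bX)
    : Prop :=
  [/\ hausdorff_space bX, compact [set: bX],
      topological_embedding e & dense (range e)].

Definition countable_character (T : topologicalType) (K : set T) : Prop :=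
  exists B : set (set T),
    [/\ countable B,
        (forall U, B U -> open U /\ K `<=` U) &
        (forall V, open V -> K `<=` V -> exists2 U, B U & U `<=` V)].

Definition neighborhood_assignment (T : topologicalType) (phi : T -> set T)
    : Prop :=
  forall x, open (phi x) /\ phi x x.

Definition discrete_subset (T : topologicalType) (D : set T) : Prop :=
  isolated D = D.

Definition D_space (T : topologicalType) : Prop :=
  forall phi : T -> set T, neighborhood_assignment phi ->
  exists D : set T,
    [/\ closed D, discrete_subset D & \bigcup_(d in D) phi d = [set: T]].

Definition upper_semicontinuous (M Z : topologicalType) (Phi : M -> set Z)
    : Prop :=
  forall U : set Z, open U -> open [set m | Phi m `<=` U].

Definition lindelof_sigma (Z : topologicalType) : Prop :=
  exists (M : topologicalType) (Phi : M -> set Z),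
    [/\ tychonoff_space M /\ @second_countable M,
        (forall m, compact (Phi m) /\ Phi m !=set0),
        upper_semicontinuous Phi &
        \bigcup_m Phi m = [set: Z]].

Definition lindelof_sigma_kernel (R : topologicalType) (Y : set R) : Prop :=
  lindelof_sigma (set_type Y) /\
  (forall U : set R, open U -> Y `<=` U -> lindelof_sigma (set_type (~` U))).

Definition charming (R : topologicalType) : Prop :=
  exists Y : set R, lindelof_sigma_kernel Y.

(* Main.v *)
(** Since the singletons of bX are closed, a countable character base B of K
    shows that R is the union of Y and the countably many sets R \ U, U in B,
    all of them Lindelöf Sigma.  Images under Phi of a countable base then give
    R a countable network modulo a cover by compact sets.

    Such a T1 space is a D-space: build finite sets D_0, D_1, ... where D_(n+1)
    adds to D_n, if possible, a finite set F outside phi(D_n) such that phi(F)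
    covers what phi(D_n) leaves of a prescribed network member.  Their union E
    meets each phi(d), d in E, in a finite set.  If phi(E) missed a point of
    some compact member C of the cover, then C would be covered by phi of a
    finite subset of some D_n together with phi(F) for a finite F outside
    phi(E).  Since F also lies outside every phi(D_m), a network member lying
    between that point and this cover stays eligible at all later stages, hence
    gets covered. *)
Require Import Defs.
From mathcomp Require Import all_boot all_classical all_reals.
From mathcomp Require Import topology urysohn.

Local Open Scope classical_set_scope.

(** Only [x], not all of [C], has to lie in [P]. Since [C] and [U] live in the ambient space,
    networks of several pieces can simply be united. *)
Definition network_mod_compact {T : topologicalType} (A : set T)
    (N : set (set T)) : Prop :=
  forall x, A x -> exists C, [/\ compact C, C x &
    forall U, open U -> C `<=` U -> exists2 P, N P & P x /\ P `<=` U].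

Definition has_countable_network_mod_compact {T : topologicalType} (A : set T)
    : Prop :=
  exists2 N, countable N & network_mod_compact A N.

Lemma compact_finite_nbhd_cover {T : topologicalType} (C S : set T)
    (phi : T -> set T) :
  compact C -> (forall x, open (phi x)) -> C `<=` \bigcup_(x in S) phi x ->
  exists G, [/\ finite_set G, G `<=` S & C `<=` \bigcup_(x in G) phi x].
Proof.
move=> /compact_near_coveringP cC ophi CS.
(* A property holds along [F] when it holds for all sufficiently large finite subsets of [S];
   near-covering compactness then yields a single finite set for all of [C]. *)
pose F : set_system (set T) :=
  filter_from [set G | finite_set G /\ G `<=` S]
    (fun G => [set H | [/\ finite_set H, H `<=` S & G `<=` H]]).
have FF : Filter F.
  apply: filter_from_filter; first by exists set0; split; [exact: finite_set0|].
  move=> G H [fG GS] [fH HS]; exists (G `|` H).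
    by split; [rewrite finite_setU | rewrite subUset].
  move=> K [fK KS]; rewrite subUset => -[GK HK].
  by split; split.
have [] := cC _ F (fun G y => (\bigcup_(x in G) phi x) y) FF.
  move=> y /CS[x Sx phixy].
  exists (phi x, [set H | [/\ finite_set H, H `<=` S & [set x] `<=` H]]).
    split; first by apply: open_nbhs_nbhs; split => //; exact: ophi.
    exists [set x] => //; split; first exact: finite_set1.
    by move=> _ ->.
  by move=> [y' H] [/= phixy' [_ _ xH]]; exists x => //; exact: xH.
move=> G [fG GS] /(_ G) CG.
by exists G; split => //; apply: CG; split.
Qed.

Lemma finite_subset_bigcup_nondecreasing {T : choiceType} (D : nat -> set T)
    (G : set T) :
  {homo D : m n / m <= n >-> m `<=` n} ->
  finite_set G -> G `<=` \bigcup_n D n -> exists n, G `<=` D n.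
Proof.
move=> homoD /finite_seqP[s ->]; elim: s => [|x s IHs] sD.
  by exists 0%N => x.
have [|n sDn] := IHs; first by move=> y ys; apply: sD; rewrite /= inE ys orbT.
have [|m _ Dmx] := sD x; first by rewrite /= mem_head.
exists (maxn m n) => y /=; rewrite inE => /orP[/eqP ->|ys].
  exact: homoD (leq_maxl m n) _ Dmx.
exact: homoD (leq_maxr m n) _ (sDn _ ys).
Qed.

Lemma countable_sub_range {T : Type} (A : set T) (x0 : T) :
  countable A -> exists f : nat -> T, A `<=` range f.
Proof.
case/pfcard_geP => [->|/surjfunPex[f ->]]; first by exists (fun=> x0).
by exists f.
Qed.

(** Both properties are local, and on each member of the open cover by the [phi d] the trace of [D]
    is finite, hence closed in a T1 space. *)
Lemma closed_discrete_of_finite_traces {T : topologicalType}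
    (phi : T -> set T) (D : set T) :
  accessible_space T -> neighborhood_assignment phi ->
  (forall d, D d -> finite_set (phi d `&` D)) ->
  \bigcup_(d in D) phi d = [set: T] ->
  closed D /\ discrete_subset D.
Proof.
move=> /accessible_finite_set_closed T1 nphi fD covD; split.
  move=> z clDz.
  have [d Dd phidz] : (\bigcup_(d in D) phi d) z by rewrite covD.
  suff [] : (phi d `&` D) z by [].
  apply: (T1 _ (fD _ Dd)) => B Bz.
  have [y [Dy [By phidy]]] : D `&` (B `&` phi d) !=set0.
    apply: clDz; apply: filterI => //.
    by apply: open_nbhs_nbhs; split => //; case: (nphi d).
  by exists y.
apply/seteqP; split; first exact: isolatedS.
move=> d Dd; split; first exact: mem_set.
have [ophi phidd] := nphi d.
exists (phi d `&` ~` ((phi d `&` D) `\ d)).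
  apply: open_nbhs_nbhs; split; last by split => // -[_]; apply.
  apply: openI => //; apply: closed_openC; apply: T1.
  exact: finite_setD (fD _ Dd).
apply/seteqP; split => [x [[phidx nx] Dx]|x ->].
  by apply: contrapT => xd; apply: nx; split.
by split => //; split => // -[_]; apply.
Qed.

Lemma D_space_of_network {T : topologicalType} :
  accessible_space T -> has_countable_network_mod_compact [set: T] ->
  D_space T.
Proof.
move=> T1 [NN /(countable_sub_range NN set0)[N subN] netN] phi nphi.
have ophi x : open (phi x) by case: (nphi x).
pose st (D : set T) := \bigcup_(d in D) phi d.
have st_mono A B : A `<=` B -> st A `<=` st B by exact: bigcup_subset.
pose good k D F := [/\ finite_set F, F `<=` ~` st D & N k `<=` st (D `|` F)].
(* The default [set0] keeps finiteness and avoidance of [st p.2] true even at stages where no [good]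
   set exists. *)
have /choice[next nextP] (p : nat * set T) : exists F,
    [/\ finite_set F, F `<=` ~` st p.2 &
        (exists G, good p.1 p.2 G) -> N p.1 `<=` st (p.2 `|` F)].
  have [[F [fF FD NF]]|nF] := pselect (exists G, good p.1 p.2 G).
    by exists F; split.
  by exists set0; split.
(* Every k equals logn 2 n for arbitrarily large n, so each member N k of the
   network is revisited infinitely often. *)
pose D := fix D n :=
  if n is m.+1 then D m `|` next (logn 2 m, D m) else set0.
have homoD : {homo D : m n / m <= n >-> m `<=` n}.
  by apply: homo_leq => [A//|B A C|n x Dx]; [exact: subset_trans | left].
pose E := \bigcup_n D n.
have DE n : D n `<=` E by exact: bigcup_sup.
have finD n : finite_set (D n).
  elim: n => [|n IHn]; first exact: finite_set0.
  by rewrite /= finite_setU; split => //; case: (nextP (logn 2 n, D n)).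
(* Points added from stage [n] on avoid [st (D n)], so any point of [E] in [st (D n)] was already in
   [D n]. *)
have trace m n : D m `&` st (D n) `<=` D n.
  elim: m => [x []//|m IHm] x [/= [Dmx|nxtx] stx]; first exact: IHm.
  have [nm|mn] := leqP n m.
    case: (nextP (logn 2 m, D m)) => _ /(_ _ nxtx) /= nst _.
    by exfalso; apply: nst; exact: st_mono (homoD _ _ nm) _ stx.
  by apply: homoD mn _ _; right.
have covE : st E = [set: T].
  apply/seteqP; split => // z _; apply: contrapT => nz.
  have [C [cC Cz netC]] := netN z I.
  (* Points of [C] in [st E] are covered from [E], the others by their own neighborhoods. *)
  have [|G [fG GS CG]] :=
    compact_finite_nbhd_cover C (E `|` ~` st E) phi cC ophi.
    move=> x Cx; have [[d Ed phidx]|nx] := pselect (st E x).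
      by exists d => //; left.
    by exists x; [right | case: (nphi x)].
  have [||n GDn] := finite_subset_bigcup_nondecreasing D (G `&` E) homoD.
  - exact: finite_setIl.
  - by move=> x [].
  have [P /subN[k _ <-] [Nkz NkG]] :=
    netC _ (bigcup_open (fun x _ => ophi x)) CG.
  (* Stage [n'] treats [N k], and comes late enough for [D n'] to contain [G] [&] [E]. *)
  pose n' := (2 ^ k * 3 ^ n)%N.
  have logn' : logn 2 n' = k.
    by rewrite lognM ?expn_gt0// pfactorK// lognX muln0 addn0.
  have nn' : n <= n'.
    rewrite (leq_trans (ltnW (ltn_expl n (isT : 1 < 3))))//.
    by rewrite leq_pmull// expn_gt0.
  have [_ _ /= Nk] := nextP (logn 2 n', D n').
  apply: nz; apply: (st_mono (D n'.+1)); first exact: DE.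
  rewrite logn' in Nk; rewrite /= logn'; apply: Nk Nkz.
  (* The points of [G] outside [E] lie outside [st E], so they are still eligible at stage [n']. *)
  exists (G `\` E); split; first exact: finite_setD.
    move=> x [/GS[//|nEx] _]; apply: contra_not nEx.
    exact: st_mono (DE n') x.
  apply: subset_trans NkG _; apply: st_mono => x Gx.
  have [Ex|nEx] := pselect (E x); last by right.
  by left; apply: homoD nn' _ _; apply: GDn.
have [clE discE] : closed E /\ discrete_subset E.
  apply: closed_discrete_of_finite_traces nphi _ covE => //.
  move=> d [n _ Dnd]; apply: sub_finite_set (finD n) => x [phidx [m _ Dmx]].
  by apply: (trace m); split => //; exists d.
by exists E.
Qed.

Lemma set_val_continuous {T : topologicalType} (A : set T) :
  continuous (set_val : set_type A -> T).
Proof. exact: initial_continuous. Qed.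

(** By upper semicontinuity, a whole basic neighborhood of [m] is sent into any open set containing
    [Phi m]. *)
Lemma lindelof_sigma_network {T : topologicalType} (A : set T) :
  lindelof_sigma (set_type A) -> has_countable_network_mod_compact A.
Proof.
move=> [M [Phi [[_ [B cB [oB basisB]]] cPhi uscPhi covPhi]]].
exists [set set_val @` (\bigcup_(m in b) Phi m) | b in B].
  exact: sub_countable (card_image_le _ _) _.
move=> x Ax.
have [m _ Phimx] : (\bigcup_m Phi m) (exist _ x (mem_set Ax)).
  by rewrite covPhi.
exists (set_val @` Phi m); split.
- apply: continuous_compact; last by case: (cPhi m).
  exact/continuous_subspaceT/set_val_continuous.
- by exists (exist _ x (mem_set Ax)).
move=> U oU sPhiU.
have oV : open [set m' | Phi m' `<=` set_val @^-1` U].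
  by apply: uscPhi; move/continuousP : (set_val_continuous A); exact.
have [b [Bb bm] bV] : filter_from [set b | B b /\ b m] id
    [set m' | Phi m' `<=` set_val @^-1` U].
  apply: basisB; apply: open_nbhs_nbhs; split => // y Phimy /=.
  by apply: sPhiU; exists y.
exists (set_val @` (\bigcup_(m in b) Phi m)); first by exists b.
split; first by exists (exist _ x (mem_set Ax)) => //; exists m.
by move=> _ [y [m' bm' Phim'y] <-]; exact: (bV m').
Qed.

Lemma network_mod_compact_bigcup {T : topologicalType} {I : Type} (D : set I)
    (A : I -> set T) :
  countable D ->
  (forall i, D i -> has_countable_network_mod_compact (A i)) ->
  has_countable_network_mod_compact (\bigcup_(i in D) A i).
Proof.
move=> cD netA.
have /choice[N NP] i : exists N,
    D i -> countable N /\ network_mod_compact (A i) N.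
  have [/netA[N cN netN]|nDi] := pselect (D i); first by exists N.
  by exists set0.
exists (\bigcup_(i in D) N i).
  by apply: bigcup_countable => // i /NP[].
move=> x [i Di Aix]; have [_ netN] := NP i Di.
have [C [cC Cx netC]] := netN x Aix.
exists C; split => // U oU CU; have [P NP' [Px PU]] := netC U oU CU.
by exists P => //; exists i.
Qed.

Lemma accessible_set_type {T : topologicalType} (A : set T) :
  accessible_space T -> accessible_space (set_type A).
Proof.
move=> T1 x y xy; have [|U [oU Ux Uy]] := T1 (set_val x) (set_val y).
  by rewrite (inj_eq val_inj).
exists (set_val @^-1` U); split.
- by move/continuousP : (set_val_continuous A); exact.
- by apply/mem_set; exact: set_mem Ux.
- by apply/mem_set; exact: set_mem Uy.
Qed.

Theorem lemma3p43 (X bX : topologicalType) (e : X -> bX)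
    (tychX : tychonoff_space X)
    (cptX : hausdorff_compactification e)
    (R : set bX) (defR : R = ~` range e)
    (charmR : charming (set_type R))
    (Y : set (set_type R)) (kerY : lindelof_sigma_kernel Y)
    (exK : exists K : set bX,
       [/\ compact K, countable_character K & set_val @` Y = K `&` R]) :
  D_space (set_type R).
Proof.
have bXT1 : accessible_space bX by case: cptX => /hausdorff_accessible.
have [K [_ [B [cB openB baseB]] YK]] := exK; have [LY LU] := kerY.
apply: D_space_of_network; first exact: accessible_set_type R bXT1.
pose V U : set (set_type R) := set_val @^-1` U.
pose pieces := [set ~` V U | U in B] `|` [set Y].
have -> : [set: set_type R] = \bigcup_(A in pieces) A.
  apply/seteqP; split => // z _.
  have [Kz|nKz] := pselect (K (set_val z)).
    have [y Yy /val_inj <-] : (set_val @` Y) (set_val z).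
      by rewrite YK; split => //; exact: set_valP.
    by exists Y => //; right.
  have [||U BU Uz] := baseB (~` [set set_val z]).
  - exact/closed_openC/accessible_closed_set1.
  - by move=> x Kx /= xz; apply: nKz; rewrite -xz.
  by exists (~` V U); [left; exists U | move=> /Uz; apply].
apply: network_mod_compact_bigcup.
  (* The binary union becomes a union over [nat], empty from index 2 on. *)
  rewrite /pieces -bigcup2E; apply: bigcup_countable => // -[|[|n]] _ /=.
  - exact: sub_countable (card_image_le _ _) _.
  - exact: countable1.
  - exact: countable0.
move=> _ [[U BU <-]|->]; apply: lindelof_sigma_network _ _ => //.
(* The kernel property applies to [V U], which contains [Y] because [Y] lies in [K] and [K] in
   [U]. *)
have [oU KU] := openB U BU; apply: LU.
  by move/continuousP : (set_val_continuous R); exact.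
move=> y Yy; apply: KU.
by have [] : (K `&` R) (set_val y) by rewrite -YK; exists y.
Qed.
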